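(* Let $\Omega_n=\dfrac{\pi^{n/2}}{\Gamma\left(\frac n2+1\right)}$ for $n\in\mathbb{N}$. As $n\to\infty$, the following asymptotic series holds: \[ \frac{1}{n}\ln \Omega _{n}\sim -\frac{n+1}{2n}\ln \frac{n}{2}+\frac{1}{2}\ln\left( \pi e\right) -\frac{\ln 2\pi }{2n}-\sum_{j=1}^{\infty }\frac{2^{2j-2}B_{2j}}{j\left( 2j-1\right) n^{2j}}, \] where $B_{k}$ denote the Bernoulli numbers.
   Context: $\Omega_n$ is the volume of the unit ball in $\mathbb{R}^n$; $\Gamma$ is Euler's gamma function. The Bernoulli numbers $B_k$ are defined by $\frac{t}{e^t-1}=\sum_{k\ge0}B_k\frac{t^k}{k!}$ (so $B_2=\frac16$, $B_4=-\frac1{30}$). An asymptotic series $f(n)\sim g(n)+\sum_{j\ge1} a_j n^{-j}$ means that for every $N$, $f(n)-g(n)-\sum_{j=1}^{N}a_jn^{-j}=O(n^{-N-1})$ as $n\to\infty$. *)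

(* Defs.v *)
From Stdlib Require Import Reals.
From Coquelicot Require Import Coquelicot.
Open Scope R_scope.

Definition Gamma (x : R) : R :=
  RInt_gen (fun t => Rpower t (x - 1) * exp (- t)) (at_right 0) (Rbar_locally p_infty).

Definition Omega (n : nat) : R :=
  Rpower PI (INR n / 2) / Gamma (INR n / 2 + 1).

Definition bern_gen (t : R) : R :=
  if Req_EM_T t 0 then 1 else t / (exp t - 1).

(* Bernoulli numbers: t/(e^t-1) = sum_k B_k t^k / k!, i.e. B_k = k-th derivative at 0. *)
Definition Bernoulli (k : nat) : R := Derive_n bern_gen k 0.

Definition main_part (n : nat) : R :=
  - (INR n + 1) / (2 * INR n) * ln (INR n / 2) + / 2 * ln (PI * exp 1)
  - ln (2 * PI) / (2 * INR n).

(* Coefficient a_k of n^{-k} in the series: zero for odd k, and for k = 2j (j >= 1)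
   a_{2j} = - 2^{2j-2} B_{2j} / (j (2j-1)). *)
Definition coeff (k : nat) : R :=
  if Nat.odd k then 0
  else let j := Nat.div2 k in
       - (2 ^ (2 * j - 2) * Bernoulli (2 * j)) / (INR j * (2 * INR j - 1)).

(* Main.v *)
(** Write [x = n/2], so that [Omega n = PI^x / Gamma (x + 1)]; the claim is Stirling's series for
    [ln Gamma (x + 1)] at integers and half-integers.  With [e_0 = y ln y - y] and
    [e_{k+1} = - e_k'], and [p_k] the Bernoulli polynomials divided by [k!], the sum
    [sum_{k <= m} p_k(s) e_k(x + s)] has derivative [- p_m(s) e_{m+1}(x + s)] in [s], so the mean
    value theorem on [[0, 1]] shows that [A(x) = sum_{k <= m} (B_k / k!) e_k(x)] satisfies
    [A(x + 1) - A(x) = ln (x + 1) + O(x^-m)].  Hence [ln Gamma (x + 1) - A(x)] converges along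
    [x + k], and its distance to the limit is [O(x^(1-m))].  The limit along integers equals the one
    along half-integers because [Gamma (y + 1/2) <= sqrt y Gamma y], and the duplication formula
    together with Wallis' evaluation [Gamma (1/2) = sqrt PI] identifies it as [ln (2 PI) / 2]. *)

Require Import Defs.
From Stdlib Require Import Reals Lra Lia Factorial Wf_nat Arith Classical_Prop.
From Coquelicot Require Import Coquelicot.
Open Scope R_scope.

(** * Bernoulli numbers *)

Definition inv_fact_S (k : nat) : R := / INR (fact (S k)).

(* [beta k] is [B_k / k!], defined by the recurrence for the inverse power series of
   [(exp t - 1) / t]; [beta_upto n] is correct on [0..n]. *)
Fixpoint beta_upto (n : nat) : nat -> R :=
  match n with
  | O => fun _ => 1
  | S m => fun k =>
      if Nat.leb k m then beta_upto m k
      else - sum_f_R0 (fun i => inv_fact_S (S i) * beta_upto m (m - i)) m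
  end.

Definition beta (n : nat) : R := beta_upto n n.

Lemma beta_upto_eq (n k : nat) : (k <= n)%nat -> beta_upto n k = beta k.
Proof.
  induction n as [|n IH]; intros Hk.
  - now replace k with O by lia.
  - destruct (Nat.eq_dec k (S n)) as [->|Hne]; [reflexivity|].
    simpl; replace (Nat.leb k n) with true by (symmetry; apply Nat.leb_le; lia).
    apply IH; lia.
Qed.

Lemma beta_0 : beta 0 = 1.
Proof. reflexivity. Qed.

Lemma beta_S (n : nat) :
  beta (S n) = - sum_f_R0 (fun i => inv_fact_S (S i) * beta (n - i)) n.
Proof.
  unfold beta at 1; cbn [beta_upto].
  replace (Nat.leb (S n) n) with false by (symmetry; apply Nat.leb_gt; lia).
  f_equal; apply sum_eq; intros i Hi.
  rewrite beta_upto_eq; [reflexivity | lia].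
Qed.

(** The recurrence [beta_S] rearranged as a Cauchy product. It serves twice: for the generating
    function, and for the values of the Bernoulli polynomials at 1. *)
Lemma PS_mult_inv_fact_beta (n : nat) :
  PS_mult inv_fact_S beta n = if Nat.eq_dec n 0 then 1 else 0.
Proof.
  unfold PS_mult; destruct n as [|n]; simpl Nat.eq_dec; cbv iota.
  - simpl; rewrite beta_0; unfold inv_fact_S; simpl; field.
  - rewrite decomp_sum by lia.
    change (inv_fact_S 0 * beta (S n)
            + sum_f_R0 (fun i => inv_fact_S (S i) * beta (n - i)) n = 0).
    rewrite beta_S; unfold inv_fact_S at 1; simpl fact; simpl INR; field.
Qed.

Lemma inv_fact_S_bound (k : nat) : 0 < inv_fact_S k <= (/ 2) ^ k.
Proof.
  unfold inv_fact_S; split; [apply Rinv_0_lt_compat, INR_fact_lt_0|].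
  rewrite pow_inv; apply Rinv_le_contravar; [apply pow_lt; lra|].
  induction k as [|k IH]; [simpl; lra|].
  change (fact (S (S k))) with (S (S k) * fact (S k))%nat.
  rewrite mult_INR, S_INR, S_INR; simpl pow.
  pose proof (pos_INR k); pose proof (INR_fact_lt_0 (S k)); nra.
Qed.

Lemma sum_half_pow (n : nat) : sum_f_R0 (fun i => (/ 2) ^ S i) n = 1 - (/ 2) ^ S n.
Proof.
  induction n as [|n IH]; [simpl; field|].
  rewrite tech5, IH; simpl; field.
Qed.

(** Strong induction: the weights [1 / (i + 2)!] of the recurrence are at most [2^-(i+1)], and these
    sum to less than 1. This crude bound gives a convergence radius of at least 1, which suffices
    for derivatives at 0. *)
Lemma beta_bound (n : nat) : Rabs (beta n) <= 1.
Proof.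
  induction n as [n IH] using lt_wf_ind.
  destruct n as [|n]; [rewrite beta_0, Rabs_R1; lra|].
  rewrite beta_S, Rabs_Ropp.
  eapply Rle_trans; [apply Rsum_abs|].
  apply Rle_trans with (sum_f_R0 (fun i => (/ 2) ^ S i) n).
  - apply sum_Rle; intros i Hi.
    destruct (inv_fact_S_bound (S i)) as [H0 H1].
    rewrite Rabs_mult, (Rabs_pos_eq (inv_fact_S _)) by lra.
    pose proof (IH (n - i)%nat ltac:(lia)); pose proof (Rabs_pos (beta (n - i))); nra.
  - rewrite sum_half_pow; pose proof (pow_lt (/ 2) (S n) ltac:(lra)); lra.
Qed.

Lemma CV_radius_ge_1 (a : nat -> R) :
  (forall n, Rabs (a n) <= 1) -> Rbar_le 1 (CV_radius a).
Proof.
  intros Ha; apply CV_radius_bounded; exists 1; intros n.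
  rewrite pow1, Rmult_1_r; apply Ha.
Qed.

Lemma inside_CV_radius (a : nat -> R) (t : R) :
  (forall n, Rabs (a n) <= 1) -> Rabs t < 1 -> Rbar_lt (Rabs t) (CV_radius a).
Proof.
  intros Ha Ht; eapply Rbar_lt_le_trans; [|apply CV_radius_ge_1, Ha]; exact Ht.
Qed.

Lemma PSeries_inv_fact_S (t : R) : t * PSeries inv_fact_S t = exp t - 1.
Proof.
  pose proof (is_exp_Reals t) as H.
  pose proof (PSeries_decr_1 _ t (ex_intro _ _ H)) as H1.
  rewrite (is_pseries_unique _ _ _ H) in H1.
  change (PSeries (PS_decr_1 _) t) with (PSeries inv_fact_S t) in H1.
  rewrite H1; simpl; field.
Qed.

(** The series of [inv_fact_S] sums to [(exp t - 1) / t] for nonzero [t], and its product with that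
    of [beta] is 1, so the latter is the reciprocal; [t = 0] is settled by the constant term. *)
Lemma bern_gen_PSeries (t : R) : Rabs t < 1 -> bern_gen t = PSeries beta t.
Proof.
  intros Ht.
  assert (Hmul : PSeries inv_fact_S t * PSeries beta t = 1).
  { rewrite <- PSeries_mult.
    - rewrite (PSeries_ext _ _ _ PS_mult_inv_fact_beta).
      apply is_pseries_unique.
      pose proof (is_pseries_R (fun n => if Nat.eq_dec n 0 then 1 else 0) t 1) as [_ H].
      apply H; clear H.
      apply is_series_ext with (fun n => if Nat.eq_dec n 0 then 1 else 0).
      + intros [|n]; simpl; ring.
      + change (is_lim_seq (sum_n (fun n => if Nat.eq_dec n 0 then 1 else 0)) 1).
        apply is_lim_seq_ext with (fun _ => 1); [|apply is_lim_seq_const].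
        intros n; induction n as [|n IH]; [now rewrite sum_O|].
        rewrite sum_Sn, <- IH; unfold plus; simpl; ring.
    - apply inside_CV_radius; [intros n|exact Ht].
      destruct (inv_fact_S_bound n) as [H0 H1]; rewrite Rabs_pos_eq by lra.
      apply Rle_trans with (1 := H1); rewrite <- (pow1 n); apply pow_incr; lra.
    - apply inside_CV_radius; [exact beta_bound|exact Ht]. }
  unfold bern_gen; destruct (Req_EM_T t 0) as [->|Ht0].
  - now rewrite PSeries_0, beta_0.
  - pose proof (PSeries_inv_fact_S t) as HE.
    assert (HE0 : PSeries inv_fact_S t <> 0) by (intros H0; rewrite H0 in Hmul; lra).
    rewrite <- HE.
    apply Rmult_eq_reg_l with (PSeries inv_fact_S t); [|exact HE0].
    rewrite Hmul; field; auto.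
Qed.

Lemma locally_Rabs_lt_1 (P : R -> Prop) :
  (forall t, Rabs t < 1 -> P t) -> locally 0 P.
Proof.
  intros HP; exists (mkposreal 1 Rlt_0_1); intros t Ht; apply HP.
  replace t with (minus t 0) by (unfold minus, plus, opp; simpl; ring).
  exact Ht.
Qed.

Lemma Bernoulli_beta (n : nat) : Bernoulli n = beta n * INR (fact n).
Proof.
  unfold Bernoulli.
  rewrite (Derive_n_ext_loc bern_gen (PSeries beta)).
  - apply Derive_n_coef.
    rewrite <- Rabs_R0; apply inside_CV_radius; [exact beta_bound|].
    rewrite Rabs_R0; lra.
  - apply locally_Rabs_lt_1, bern_gen_PSeries.
Qed.

Lemma ex_derive_n_bern_gen (n : nat) (t : R) : Rabs t < 1 -> ex_derive_n bern_gen n t.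
Proof.
  intros Ht.
  apply ex_derive_n_ext_loc with (PSeries beta).
  - assert (Hd : 0 < 1 - Rabs t) by lra.
    exists (mkposreal _ Hd); intros y Hy; symmetry; apply bern_gen_PSeries.
    change (Rabs (y - t) < 1 - Rabs t) in Hy.
    replace y with ((y - t) + t) by ring.
    eapply Rle_lt_trans; [apply Rabs_triang|]; lra.
  - apply ex_derive_n_PSeries, inside_CV_radius; [exact beta_bound|exact Ht].
Qed.

Lemma bern_gen_opp (t : R) : bern_gen (- t) = bern_gen t + t.
Proof.
  unfold bern_gen.
  destruct (Req_EM_T (- t) 0), (Req_EM_T t 0); try lra.
  rewrite exp_Ropp.
  assert (exp t <> 1) by (intros H; rewrite <- exp_0 in H; apply exp_inv in H; lra).
  pose proof (exp_pos t); field; lra.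
Qed.

(** Differentiating [bern_gen (- t) = bern_gen t + t] an odd number [n >= 3] of times at 0 kills the
    term [t] and gives [- B_n = B_n]. The index starts at 3 because [B_1 = - 1/2]. *)
Lemma Bernoulli_odd (j : nat) : Bernoulli (2 * j + 3) = 0.
Proof.
  set (n := (2 * j + 3)%nat); unfold Bernoulli.
  assert (H1 := Derive_n_comp_opp bern_gen n 0).
  rewrite Ropp_0 in H1.
  rewrite (Derive_n_ext _ (fun t => bern_gen t + t ^ 1)) in H1
    by (intros t; rewrite bern_gen_opp; ring).
  rewrite Derive_n_plus, Derive_n_pow_bigi in H1.
  - replace ((-1) ^ n) with (-1) in H1; [|symmetry].
    + enough (Derive_n bern_gen n 0 + 0 = -1 * Derive_n bern_gen n 0) by lra.
      apply H1, locally_Rabs_lt_1; intros; now apply ex_derive_n_bern_gen.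
    + unfold n; replace (2 * j + 3)%nat with (S (2 * (j + 1))) by lia; apply pow_1_odd.
  - unfold n; lia.
  - apply locally_Rabs_lt_1; intros; now apply ex_derive_n_bern_gen.
  - apply locally_Rabs_lt_1; intros; apply ex_derive_n_pow.
Qed.

(** * The Euler-Maclaurin step *)

(* The Bernoulli polynomial [B_n(s)] divided by [n!]. *)
Definition bern_poly (n : nat) (s : R) : R :=
  sum_f_R0 (fun i => s ^ i / INR (fact i) * beta (n - i)) n.

Lemma bern_poly_0 (n : nat) : bern_poly n 0 = beta n.
Proof.
  unfold bern_poly; destruct n as [|n]; [simpl; rewrite beta_0; field|].
  rewrite decomp_sum by lia.
  rewrite (sum_eq _ (fun _ => 0)), sum_cte.
  - rewrite Nat.sub_0_r; simpl; field.
  - intros i _; simpl; unfold Rdiv; ring.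
Qed.

(** Without its constant term, the sum at [s = 1] is the Cauchy product of [inv_fact_S] and [beta]
    at [n - 1], which is nonzero only for [n = 1]. *)
Lemma bern_poly_1 (n : nat) :
  bern_poly n 1 = beta n + if Nat.eq_dec n 1 then 1 else 0.
Proof.
  unfold bern_poly; destruct n as [|n]; [simpl; rewrite beta_0; field|].
  rewrite decomp_sum by lia.
  rewrite (sum_eq _ (fun i => inv_fact_S i * beta (n - i))).
  - change (sum_f_R0 _ (Nat.pred (S n))) with (PS_mult inv_fact_S beta n).
    rewrite PS_mult_inv_fact_beta, Nat.sub_0_r.
    destruct (Nat.eq_dec n 0), (Nat.eq_dec (S n) 1); try lia; simpl; field.
  - intros i _; rewrite pow1; unfold Rdiv, inv_fact_S; rewrite Rmult_1_l; reflexivity.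
Qed.

Lemma bern_poly_bound (n : nat) (s : R) : 0 <= s <= 1 -> Rabs (bern_poly n s) <= INR (S n).
Proof.
  intros Hs; unfold bern_poly.
  eapply Rle_trans; [apply Rsum_abs|].
  rewrite <- (Rmult_1_l (INR (S n))), <- sum_cte.
  apply sum_Rle; intros i _.
  rewrite Rabs_mult; rewrite <- (Rmult_1_l 1).
  apply Rmult_le_compat; try apply Rabs_pos; [|apply beta_bound].
  assert (H0 : 0 <= s ^ i <= 1).
  { split; [apply pow_le; lra|]; rewrite <- (pow1 i); apply pow_incr; lra. }
  assert (H1 : 0 < / INR (fact i) <= 1).
  { split; [apply Rinv_0_lt_compat, INR_fact_lt_0|].
    rewrite <- Rinv_1; apply Rinv_le_contravar; [lra|].
    apply (le_INR 1), lt_O_fact. }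
  unfold Rdiv; rewrite Rabs_mult, !Rabs_pos_eq by lra; nra.
Qed.

Lemma is_derive_sum_f_R0 (f : nat -> R -> R) (d : nat -> R) (n : nat) (x : R) :
  (forall k, (k <= n)%nat -> is_derive (f k) x (d k)) ->
  is_derive (fun y => sum_f_R0 (fun k => f k y) n) x (sum_f_R0 d n).
Proof.
  induction n as [|n IH]; intros H; simpl; [now apply H|].
  apply (is_derive_plus (fun y => sum_f_R0 (fun k => f k y) n) (f (S n))); auto.
Qed.

Lemma is_derive_bern_poly (n : nat) (s : R) :
  is_derive (bern_poly (S n)) s (bern_poly n s).
Proof.
  apply is_derive_ext with (fun s => beta (S n) +
    sum_f_R0 (fun i => s ^ S i / INR (fact (S i)) * beta (n - i)) n).
  { intros t; unfold bern_poly; rewrite (decomp_sum _ (S n)) by lia.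
    change (Nat.pred (S n)) with n; rewrite Nat.sub_0_r.
    f_equal; simpl; field. }
  rewrite <- (Rplus_0_l (bern_poly n s)).
  apply (is_derive_plus (fun _ => beta (S n))
    (fun s => sum_f_R0 (fun i => s ^ S i / INR (fact (S i)) * beta (n - i)) n));
    [exact (is_derive_const (beta (S n)) s)|].
  apply (is_derive_sum_f_R0 (fun i s => s ^ S i / INR (fact (S i)) * beta (n - i))).
  intros k _.
  auto_derive; [trivial|].
  change (match k with 0%nat => 1 | S _ => INR k + 1 end) with (INR (S k)).
  change (fact k + k * fact k)%nat with (S k * fact k)%nat; rewrite mult_INR.
  pose proof (INR_fact_lt_0 k); pose proof (pos_INR k); rewrite S_INR; field; lra.
Qed.

(* [em_fun k] is the k-th derivative of [y ln y - y], up to the sign [(-1)^k]. *)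
Definition em_fun (k : nat) (y : R) : R :=
  match k with
  | O => y * ln y - y
  | S O => - ln y
  | S (S j) => INR (fact j) / y ^ S j
  end.

Lemma is_derive_em_fun (k : nat) (y : R) : 0 < y -> is_derive (em_fun k) y (- em_fun (S k) y).
Proof.
  intros Hy; destruct k as [|[|j]]; unfold em_fun; auto_derive; auto.
  - field; lra.
  - simpl; field; lra.
  - apply (pow_nonzero y (S j)); lra.
  - change (match j with 0%nat => 1 | S _ => INR j + 1 end) with (INR (S j)).
    change (fact (S j)) with (S j * fact j)%nat.
    rewrite mult_INR; simpl pow; field.
    split; [apply pow_nonzero|]; lra.
Qed.

(** By the product rule with [p_{k+1}' = p_k] and [e_k' = - e_{k+1}], consecutive terms cancel and
    only the last one survives. *)
Lemma is_derive_em_sum (n : nat) (x s : R) : 0 < x + s ->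
  is_derive (fun s => sum_f_R0 (fun k => bern_poly k s * em_fun k (x + s)) n) s
    (- (bern_poly n s * em_fun (S n) (x + s))).
Proof.
  intros Hy.
  assert (He : forall k, is_derive (fun s => em_fun k (x + s)) s (- em_fun (S k) (x + s))).
  { intros k.
    pose proof (is_derive_comp (em_fun k) (fun s => x + s) s (- em_fun (S k) (x + s)) 1
      (is_derive_em_fun k (x + s) Hy)) as H.
    rewrite <- (Rmult_1_l (- _)); apply H; auto_derive; [trivial|ring]. }
  induction n as [|n IH].
  - simpl sum_f_R0.
    apply is_derive_ext with (fun s => em_fun 0 (x + s)).
    + intros t; unfold bern_poly; simpl sum_f_R0; rewrite beta_0; simpl; field.
    + replace (bern_poly 0 s) with 1; [rewrite Rmult_1_l; apply He|].
      unfold bern_poly; simpl; rewrite beta_0; field.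
  - simpl sum_f_R0.
    pose proof (is_derive_plus _ _ _ _ _ IH
      (is_derive_mult _ _ _ _ _ (is_derive_bern_poly n s) (He (S n)) Rmult_comm)) as H.
    replace (- (bern_poly (S n) s * em_fun (S (S n)) (x + s))) with
      (- (bern_poly n s * em_fun (S n) (x + s))
       + (bern_poly n s * em_fun (S n) (x + s)
          + bern_poly (S n) s * - em_fun (S (S n)) (x + s))) by ring.
    exact H.
Qed.

(* The truncated Stirling series of [ln Gamma (x + 1)], without the constant [ln (2 PI) / 2]. *)
Definition stirling_sum (n : nat) (x : R) : R := sum_f_R0 (fun k => beta k * em_fun k x) n.

Lemma stirling_sum_step (n : nat) (x : R) : 0 < x ->
  Rabs (stirling_sum (S n) (x + 1) - stirling_sum (S n) x - ln (x + 1))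
  <= INR (S (S n)) * INR (fact n) / x ^ S n.
Proof.
  intros Hx.
  set (S_ := fun s => sum_f_R0 (fun k => bern_poly k s * em_fun k (x + s)) (S n)).
  assert (H0 : S_ 0 = stirling_sum (S n) x).
  { apply sum_eq; intros k _; now rewrite bern_poly_0, Rplus_0_r. }
  (* Only [p_1] differs between the two ends, by 1; this extra 1 multiplies
     [em_fun 1 (x + 1) = - ln (x + 1)]. *)
  assert (H1 : S_ 1 = stirling_sum (S n) (x + 1) - ln (x + 1)).
  { unfold S_, stirling_sum; clear; induction n as [|n IH].
    - cbn [sum_f_R0]; rewrite !bern_poly_1; simpl; ring.
    - rewrite 2(tech5 _ (S n)), IH, bern_poly_1; simpl Nat.eq_dec; cbv iota; ring. }
  destruct (MVT_gen S_ 0 1 (fun s => - (bern_poly (S n) s * em_fun (S (S n)) (x + s))))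
    as [c [Hc HE]]; rewrite ?Rmin_left, ?Rmax_right in * by lra.
  - intros s Hs; apply is_derive_em_sum; lra.
  - intros s Hs; apply continuity_pt_filterlim, (ex_derive_continuous S_ s).
    eexists; apply is_derive_em_sum; lra.
  - replace (stirling_sum (S n) (x + 1) - _ - _) with (S_ 1 - S_ 0) by (rewrite H0, H1; ring).
    rewrite HE, Rminus_0_r, Rmult_1_r, Rabs_Ropp, Rabs_mult; unfold Rdiv; rewrite Rmult_assoc.
    apply Rmult_le_compat; try apply Rabs_pos; [now apply bern_poly_bound|].
    unfold em_fun; pose proof (INR_fact_lt_0 n) as Hf.
    pose proof (pow_lt x (S n) Hx) as Hp.
    assert (Hle : x ^ S n <= (x + c) ^ S n) by (apply pow_incr; lra).
    rewrite Rabs_pos_eq; [|apply Rlt_le, Rdiv_lt_0_compat; lra].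
    apply Rmult_le_compat_l; [lra|]; apply Rinv_le_contravar; lra.
Qed.

(** * The Gamma integral at half-integers *)

Lemma near_0_infty (P : R * R -> Prop) :
  (exists a0 b0, 0 < a0 /\ forall a b, 0 < a < a0 -> b0 < b -> P (a, b)) ->
  filter_prod (at_right 0) (Rbar_locally p_infty) P.
Proof.
  intros [a0 [b0 [Ha0 HP]]].
  apply Filter_prod with (fun a => 0 < a < a0) (fun b => b0 < b).
  - exists (mkposreal _ Ha0); intros y Hy Hy0; split; [exact Hy0|].
    change (Rabs (y - 0) < a0) in Hy; rewrite Rminus_0_r, Rabs_pos_eq in Hy; lra.
  - now exists b0.
  - exact HP.
Qed.

Lemma is_RInt_gen_antiderivative (F f : R -> R) (la lb : R) :
  (forall t, 0 < t -> is_derive F t (f t)) ->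
  (forall t, 0 < t -> continuous f t) ->
  filterlim F (at_right 0) (locally la) ->
  filterlim F (Rbar_locally p_infty) (locally lb) ->
  is_RInt_gen f (at_right 0) (Rbar_locally p_infty) (lb - la).
Proof.
  intros HF Hf Hla Hlb.
  apply (filterlimi_lim_ext_loc (fun ab => F (snd ab) - F (fst ab))).
  - apply near_0_infty; exists 1, 1; split; [lra|]; intros a b Ha Hb; simpl.
    apply (is_RInt_derive F f); intros t; rewrite Rmin_left by lra; intros Ht;
      [apply HF | apply Hf]; lra.
  - apply (filterlim_comp_2 (G := locally lb) (H := locally (- la))
      (fun ab => F (snd ab)) (fun ab => - F (fst ab)) Rplus).
    + eapply filterlim_comp; [apply filterlim_snd | exact Hlb].
    + eapply filterlim_comp; [|apply (filterlim_opp (V := R_NormedModule))].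
      eapply filterlim_comp; [apply filterlim_fst | exact Hla].
    + apply (filterlim_plus (V := R_NormedModule) lb (- la)).
Qed.

Lemma ex_RInt_pos (f : R -> R) (a b : R) :
  (forall t, 0 < t -> continuous f t) -> 0 < a -> 0 < b -> ex_RInt f a b.
Proof.
  intros Hf Ha Hb; apply (ex_RInt_continuous (V := R_CompleteNormedModule)); intros t Ht; apply Hf.
  pose proof (Rmin_glb_lt a b 0 Ha Hb); lra.
Qed.

(** The integrals of [f] over compact intervals grow with the interval and are at most [2 * M],
    since those of [h] are differences of values of [H]. Their supremum is the improper integral. *)
Lemma ex_RInt_gen_dominated (f h H : R -> R) (M : R) :
  (forall t, 0 < t -> continuous f t) ->
  (forall t, 0 < t -> continuous h t) ->
  (forall t, 0 < t -> is_derive H t (h t)) ->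
  (forall t, 0 < t -> 0 <= f t <= h t) ->
  (forall t, 0 < t -> Rabs (H t) <= M) ->
  ex_RInt_gen f (at_right 0) (Rbar_locally p_infty).
Proof.
  intros Cf Ch DH Hfh HM.
  assert (HI : forall a b, 0 < a -> 0 < b -> ex_RInt f a b)
    by (intros; now apply ex_RInt_pos).
  assert (Hpos : forall a b, 0 < a -> a <= b -> 0 <= RInt f a b).
  { intros a b Ha Hb; apply RInt_ge_0; [lra | apply HI; lra|].
    intros t Ht; apply Hfh; lra. }
  destruct (completeness (fun y => exists a b, 0 < a /\ a < b /\ y = RInt f a b))
    as [l [Hub Hlub]].
  - exists (2 * M); intros y [a [b [Ha [Hb ->]]]].
    assert (HhI : is_RInt h a b (H b - H a)).
    { apply (is_RInt_derive H h); intros t; rewrite Rmin_left by lra; intros Ht;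
        [apply DH | apply Ch]; lra. }
    apply Rle_trans with (RInt h a b).
    + apply RInt_le; [lra | apply HI; lra | eexists; exact HhI|].
      intros t Ht; apply Hfh; lra.
    + rewrite (is_RInt_unique _ _ _ _ HhI).
      pose proof (HM a Ha); pose proof (HM b ltac:(lra)).
      pose proof (Rle_abs (H b)); pose proof (Rle_abs (- H a)).
      rewrite Rabs_Ropp in *; lra.
  - exists (RInt f 1 2), 1, 2; repeat split; lra.
  - exists l; apply filterlimi_locally; intros eps.
    assert (Hex : exists a b, 0 < a /\ a < b /\ l - eps < RInt f a b).
    { apply NNPP; intros Hn.
      assert (l <= l - eps); [|pose proof (cond_pos eps); lra].
      apply Hlub; intros y [a [b [Ha [Hb ->]]]].
      apply Rnot_lt_le; intros Hlt; apply Hn; exists a, b; auto. }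
    destruct Hex as [a0 [b0 [Ha0 [Hb0 Hlt]]]].
    apply near_0_infty; exists a0, b0; split; [exact Ha0|]; intros a b Ha Hb; simpl.
    exists (RInt f a b); split; [apply (RInt_correct f), HI; lra|].
    change (Rabs (RInt f a b - l) < eps).
    assert (RInt f a b <= l) by (apply Hub; exists a, b; repeat split; lra).
    (* Once [[a0, b0]] comes within [eps] of the supremum, every larger interval does too, because
       the two outer pieces are nonnegative. *)
    assert (E : RInt f a b = RInt f a a0 + RInt f a0 b0 + RInt f b0 b).
    { rewrite <- (RInt_Chasles f a b0 b), <- (RInt_Chasles f a a0 b0) by (apply HI; lra).
      reflexivity. }
    pose proof (Hpos a a0 ltac:(lra) ltac:(lra)).
    pose proof (Hpos b0 b ltac:(lra) ltac:(lra)).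
    rewrite Rabs_left1; lra.
Qed.

(** [Gamma] is a total function, meaningful only where the integral converges; the relation records
    convergence together with the value. *)
Definition is_Gamma (x g : R) : Prop :=
  is_RInt_gen (fun t => Rpower t (x - 1) * exp (- t)) (at_right 0) (Rbar_locally p_infty) g.

Lemma is_Gamma_unique (x g : R) : is_Gamma x g -> Gamma x = g.
Proof. apply (is_RInt_gen_unique (V := R_CompleteNormedModule)). Qed.

Lemma Gamma_correct (x g : R) : is_Gamma x g -> is_Gamma x (Gamma x).
Proof. intros H; now rewrite (is_Gamma_unique _ _ H). Qed.

Lemma continuous_Gamma_integrand (x t : R) :
  0 < t -> continuous (fun t => Rpower t (x - 1) * exp (- t)) t.
Proof.
  intros Ht; apply (ex_derive_continuous (fun t => Rpower t (x - 1) * exp (- t))).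
  unfold Rpower; auto_derive; auto.
Qed.

Lemma filterlim_Rpower_exp_0 (x : R) : 0 < x ->
  filterlim (fun t => exp (x * ln t - t)) (at_right 0) (locally 0).
Proof.
  intros Hx; apply filterlim_comp with (Rbar_locally m_infty); [|apply is_lim_exp_m].
  intros P [M HM].
  assert (HL : at_right 0 (fun t => ln t < M / x)).
  { apply (is_lim_ln_0 (fun y => y < M / x)); now exists (M / x). }
  destruct HL as [eps Heps]; exists eps; intros t Ht Ht0; apply HM.
  pose proof (Heps t Ht Ht0) as H1.
  apply Rmult_lt_compat_l with (r := x) in H1; [|exact Hx].
  replace (x * (M / x)) with M in H1 by (field; lra); lra.
Qed.

Lemma filterlim_Rpower_exp_infty (x : R) : 0 < x ->
  filterlim (fun t => exp (x * ln t - t)) (Rbar_locally p_infty) (locally 0).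
Proof.
  intros Hx; apply filterlim_comp with (Rbar_locally m_infty); [|apply is_lim_exp_m].
  intros P [M HM].
  assert (He : 0 < / (2 * x)) by (apply Rinv_0_lt_compat; lra).
  pose proof is_lim_div_ln_p as HL; apply is_lim_spec in HL.
  specialize (HL (mkposreal _ He)); simpl in HL.
  (* Beyond [B], [ln t / t < 1 / (2 x)], so [x ln t - t < - t / 2], which is below [M] as soon as
     [t > - 2 M]. *)
  destruct HL as [B HB]; exists (Rmax (Rmax B 0) (- 2 * M)); intros t Ht; apply HM.
  pose proof (Rmax_l (Rmax B 0) (- 2 * M)); pose proof (Rmax_r (Rmax B 0) (- 2 * M)).
  pose proof (Rmax_l B 0); pose proof (Rmax_r B 0).
  specialize (HB t ltac:(lra)); rewrite Rminus_0_r in HB.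
  pose proof (Rle_abs (ln t / t)).
  assert (Hm : ln t / t * (x * t) < / (2 * x) * (x * t)) by (apply Rmult_lt_compat_r; nra).
  replace (/ (2 * x) * (x * t)) with (t / 2) in Hm by (field; lra).
  replace (ln t / t * (x * t)) with (x * ln t) in Hm by (field; lra); lra.
Qed.

Lemma is_Gamma_S (x g : R) : 0 < x -> is_Gamma x g -> is_Gamma (x + 1) (x * g).
Proof.
  intros Hx Hg.
  (* Integration by parts: the integrand is the derivative of [t^x exp (- t)], which vanishes at
     both ends. *)
  assert (HB : is_RInt_gen (fun t => x * (Rpower t (x - 1) * exp (- t))
                                    - Rpower t (x + 1 - 1) * exp (- t))
                 (at_right 0) (Rbar_locally p_infty) (0 - 0)).
  { apply is_RInt_gen_antiderivative with (fun t => exp (x * ln t - t)).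
    - intros t Ht; auto_derive; [exact Ht|].
      replace (x + 1 - 1) with x by ring.
      replace (Rpower t (x - 1)) with (exp (x * ln t) * / t).
      2:{ unfold Rpower; rewrite <- (exp_ln t Ht) at 2; rewrite <- exp_Ropp, <- exp_plus.
          f_equal; ring. }
      unfold Rpower, Rminus; rewrite exp_plus; field; lra.
    - intros t Ht.
      apply (ex_derive_continuous (fun t => x * (Rpower t (x - 1) * exp (- t))
                                    - Rpower t (x + 1 - 1) * exp (- t))).
      unfold Rpower; auto_derive; auto.
    - now apply filterlim_Rpower_exp_0.
    - now apply filterlim_Rpower_exp_infty. }
  replace (x * g) with (minus (scal x g) (0 - 0))
    by (unfold minus, plus, opp, scal; simpl; unfold mult; simpl; ring).
  refine (is_RInt_gen_ext _ _ _ _ (is_RInt_gen_minus _ _ _ _ (is_RInt_gen_scal _ x _ Hg) HB)).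
  apply near_0_infty; exists 1, 1; split; [lra|]; intros a b _ _ t _.
  unfold minus, plus, opp, scal; simpl; unfold mult; simpl; ring.
Qed.

Lemma is_Gamma_1 : is_Gamma 1 1.
Proof.
  cut (is_Gamma 1 (0 - - 1)); [now replace (0 - - 1) with 1 by ring|].
  apply is_RInt_gen_antiderivative with (fun t => - exp (- t)).
  - intros t Ht; auto_derive; [trivial|].
    unfold Rpower; replace ((1 - 1) * ln t) with 0 by ring; rewrite exp_0; ring.
  - intros t Ht; now apply (continuous_Gamma_integrand 1).
  - replace (-1) with (- exp (- 0)) by (rewrite Ropp_0, exp_0; ring).
    assert (Hc : continuous (fun t => - exp (- t)) 0)
      by (apply (ex_derive_continuous (fun t => - exp (- t))); auto_derive; trivial).
    refine (filterlim_filter_le_1 _ _ Hc).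
    intros P [eps HP]; exists eps; auto.
  - replace (locally 0) with (Rbar_locally (- 0)) by (simpl; now rewrite Ropp_0).
    apply (is_lim_opp (fun t => exp (- t)) p_infty 0).
    apply is_lim_comp with m_infty; [apply is_lim_exp_m | |now exists 0].
    apply (is_lim_opp (fun t => t) p_infty p_infty), is_lim_id.
Qed.

(* [exp (- t) <= 1 / (1 + t)], and [1 / (sqrt t (1 + t))] is the derivative of [2 atan (sqrt t)]. *)
Lemma ex_Gamma_half : exists g, is_Gamma (/ 2) g.
Proof.
  apply ex_RInt_gen_dominated with
    (h := fun t => / (sqrt t * (1 + t))) (H := fun t => 2 * atan (sqrt t)) (M := PI).
  - intros t; apply continuous_Gamma_integrand.
  - intros t Ht; pose proof (sqrt_lt_R0 t Ht).
    apply (ex_derive_continuous (fun t => / (sqrt t * (1 + t)))).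
    auto_derive; split; auto; split; auto; nra.
  - intros t Ht; pose proof (sqrt_lt_R0 t Ht).
    auto_derive; [exact Ht|].
    rewrite Rmult_1_r, sqrt_sqrt by lra; field; lra.
  - intros t Ht; pose proof (sqrt_lt_R0 t Ht).
    replace (/ 2 - 1) with (- / 2) by field.
    rewrite Rpower_Ropp, Rpower_sqrt by exact Ht.
    rewrite exp_Ropp, <- Rinv_mult.
    pose proof (exp_ineq1_le t).
    split; [apply Rlt_le, Rinv_0_lt_compat | apply Rinv_le_contravar]; nra.
  - intros t Ht; pose proof (atan_bound (sqrt t)).
    rewrite Rabs_mult, (Rabs_pos_eq 2) by lra.
    assert (Rabs (atan (sqrt t)) <= PI / 2) by (apply Rabs_le; lra); lra.
Qed.

(* Indexed so that [Omega n = PI^(n/2) / Gamma_half n]. *)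
Definition Gamma_half (n : nat) : R := Gamma (INR n / 2 + 1).

Lemma ex_Gamma_half_int (n : nat) : exists g, is_Gamma (INR n / 2 + 1) g.
Proof.
  induction n as [n IH] using lt_wf_ind; destruct n as [|[|n]].
  - exists 1; replace (INR 0 / 2 + 1) with 1 by (simpl; field); apply is_Gamma_1.
  - destruct ex_Gamma_half as [g Hg]; exists (/ 2 * g).
    replace (INR 1 / 2 + 1) with (/ 2 + 1) by (simpl; field).
    apply is_Gamma_S; [lra | exact Hg].
  - destruct (IH n ltac:(lia)) as [g Hg]; eexists.
    replace (INR (S (S n)) / 2 + 1) with (INR n / 2 + 1 + 1) by (rewrite !S_INR; field).
    apply is_Gamma_S; [pose proof (pos_INR n); lra | exact Hg].
Qed.

Lemma is_Gamma_Gamma_half (n : nat) : is_Gamma (INR n / 2 + 1) (Gamma_half n).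
Proof. destruct (ex_Gamma_half_int n) as [g Hg]; eapply Gamma_correct, Hg. Qed.

Lemma Gamma_half_0 : Gamma_half 0 = 1.
Proof.
  unfold Gamma_half; replace (INR 0 / 2 + 1) with 1 by (simpl; field).
  apply is_Gamma_unique, is_Gamma_1.
Qed.

Lemma Gamma_half_SS (n : nat) : Gamma_half (S (S n)) = (INR n + 2) / 2 * Gamma_half n.
Proof.
  replace ((INR n + 2) / 2) with (INR n / 2 + 1) by field.
  apply is_Gamma_unique.
  replace (INR (S (S n)) / 2 + 1) with (INR n / 2 + 1 + 1) by (rewrite !S_INR; field).
  apply is_Gamma_S; [pose proof (pos_INR n); lra | apply is_Gamma_Gamma_half].
Qed.

(* AM-GM: [sqrt t <= (sqrt x + t / sqrt x) / 2]. *)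
Lemma is_Gamma_plus_half_le (x g g' : R) : 0 < x ->
  is_Gamma x g -> is_Gamma (x + / 2) g' -> g' <= sqrt x * g.
Proof.
  intros Hx Hg Hg'.
  pose proof (sqrt_lt_R0 x Hx) as Hs; pose proof (sqrt_sqrt x (Rlt_le _ _ Hx)) as Hss.
  set (s := sqrt x) in *.
  apply Rle_trans with (norm g'); [apply Rle_abs|].
  (* The right side is the Gamma integral of the AM-GM majorant, with [x * g] the value at [x + 1];
     as [x = s * s], the two halves are equal. *)
  replace (s * g) with (plus (scal (s / 2) g) (scal (/ (2 * s)) (x * g))).
  2:{ unfold plus, scal; simpl; unfold mult; simpl; rewrite <- Hss; field; lra. }
  refine (RInt_gen_norm _ _ _ _ _ _ Hg' (is_RInt_gen_plus _ _ _ _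
    (is_RInt_gen_scal _ _ _ Hg) (is_RInt_gen_scal _ _ _ (is_Gamma_S x g Hx Hg)))).
  - apply near_0_infty; exists 1, 1; split; [lra|]; simpl; intros; lra.
  - apply near_0_infty; exists 1, 1; split; [lra|]; simpl; intros a b Ha Hb t Ht.
    unfold plus, scal, norm; simpl; unfold mult, abs; simpl.
    assert (Ht0 : 0 < t) by lra.
    replace (Rpower t (x + / 2 - 1)) with (Rpower t (x - 1) * sqrt t).
    2:{ rewrite <- Rpower_sqrt, <- Rpower_plus by exact Ht0; f_equal; field. }
    replace (Rpower t (x + 1 - 1)) with (Rpower t (x - 1) * t).
    2:{ rewrite <- (Rpower_1 t Ht0) at 2; rewrite <- Rpower_plus; f_equal; ring. }
    pose proof (sqrt_lt_R0 t Ht0) as Hr; pose proof (sqrt_sqrt t (Rlt_le _ _ Ht0)) as Hrr.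
    set (r := sqrt t) in *.
    assert (HP : 0 < Rpower t (x - 1) * exp (- t)).
    { apply Rmult_lt_0_compat; [apply exp_pos | apply exp_pos]. }
    set (p := Rpower t (x - 1)) in *; set (e := exp (- t)) in *.
    rewrite Rabs_pos_eq by nra.
    apply Rminus_le_0; rewrite <- Hrr.
    match goal with |- 0 <= ?d => replace d with (p * e * ((s - r) ^ 2 / (2 * s))) end;
      [|field; lra].
    apply Rmult_le_pos; [lra|]; apply Rdiv_le_0_compat; [apply pow2_ge_0 | lra].
Qed.

Lemma Gamma_half_S_le (n : nat) :
  Gamma_half (S n) <= sqrt ((INR n + 2) / 2) * Gamma_half n.
Proof.
  replace ((INR n + 2) / 2) with (INR n / 2 + 1) by field.
  apply is_Gamma_plus_half_le; [pose proof (pos_INR n); lra | apply is_Gamma_Gamma_half |].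
  replace (INR n / 2 + 1 + / 2) with (INR (S n) / 2 + 1) by (rewrite S_INR; field).
  apply is_Gamma_Gamma_half.
Qed.

Lemma Gamma_half_pos (n : nat) : 0 < Gamma_half n.
Proof.
  induction n as [n IH] using lt_wf_ind; destruct n as [|[|n]].
  - rewrite Gamma_half_0; lra.
  (* Here [1 = Gamma_half 2 <= sqrt (3/2) * Gamma_half 1] forces positivity. *)
  - pose proof (Gamma_half_S_le 1) as H; rewrite Gamma_half_SS, Gamma_half_0 in H.
    simpl in H; pose proof (sqrt_lt_R0 ((1 + 2) / 2) ltac:(lra)).
    apply Rnot_le_lt; intros Hle; nra.
  - rewrite Gamma_half_SS; pose proof (pos_INR n); pose proof (IH n ltac:(lia)).
    apply Rmult_lt_0_compat; lra.
Qed.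

(** * Wallis and the duplication formula *)

Definition wallis (n : nat) : R := RInt (fun t => sin t ^ n) 0 (PI / 2).

Lemma ex_RInt_sin_pow (n : nat) : ex_RInt (fun t => sin t ^ n) 0 (PI / 2).
Proof.
  apply (ex_RInt_continuous (V := R_CompleteNormedModule)); intros t _.
  apply (ex_derive_continuous (fun t => sin t ^ n)); auto_derive; trivial.
Qed.

Lemma wallis_pos (n : nat) : 0 < wallis n.
Proof.
  pose proof PI2_1.
  apply RInt_gt_0; [lra | |].
  - intros t Ht; apply pow_lt, sin_gt_0; lra.
  - intros t _; apply (ex_derive_continuous (fun t => sin t ^ n)); auto_derive; trivial.
Qed.

Lemma wallis_decr (n : nat) : wallis (S n) <= wallis n.
Proof.
  pose proof PI2_1.
  apply RInt_le; [lra | apply ex_RInt_sin_pow | apply ex_RInt_sin_pow |].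
  intros t Ht; simpl.
  pose proof (SIN_bound t); pose proof (pow_lt (sin t) n (sin_gt_0 t ltac:(lra) ltac:(lra))).
  nra.
Qed.

Lemma wallis_1 : wallis 1 = 1.
Proof.
  apply is_RInt_unique.
  replace 1 with (minus (- cos (PI / 2)) (- cos 0)).
  2:{ rewrite cos_PI2, cos_0; unfold minus, plus, opp; simpl; ring. }
  apply (is_RInt_derive (fun t => - cos t)); intros t _.
  - auto_derive; [trivial | ring].
  - apply (ex_derive_continuous (fun t => sin t ^ 1)); auto_derive; trivial.
Qed.

(* Integrate the derivative of [- cos t sin t ^ (n+1)], which vanishes at both ends. *)
Lemma wallis_SS (n : nat) : (INR n + 2) * wallis (S (S n)) = (INR n + 1) * wallis n.
Proof.
  assert (H : is_RInt (fun t => (INR n + 2) * sin t ^ (S (S n)) - (INR n + 1) * sin t ^ n)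
                0 (PI / 2) 0).
  { replace 0 with (minus (- cos (PI / 2) * sin (PI / 2) ^ S n) (- cos 0 * sin 0 ^ S n)) at 2.
    2:{ rewrite cos_PI2, sin_0; unfold minus, plus, opp; simpl; ring. }
    apply (is_RInt_derive (fun t => - cos t * sin t ^ S n)); intros t _.
    - auto_derive; [trivial|].
      change (match n with 0%nat => 1 | S _ => INR n + 1 end) with (INR (S n)).
      rewrite S_INR; simpl pow; pose proof (sin2_cos2 t) as Hsc; unfold Rsqr in Hsc.
      replace (cos t * (1 * cos t)) with (1 - sin t * sin t) by lra.
      assert (Hc : cos t * cos t = 1 - sin t * sin t) by lra.
      ring_simplify; replace (cos t ^ 2) with (1 - sin t * sin t) by (rewrite <- Hc; ring).
      ring.
    - apply (ex_derive_continuous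
        (fun t => (INR n + 2) * sin t ^ (S (S n)) - (INR n + 1) * sin t ^ n)).
      auto_derive; trivial. }
  assert (H2 : is_RInt (fun t => (INR n + 2) * sin t ^ (S (S n)) - (INR n + 1) * sin t ^ n)
                0 (PI / 2) ((INR n + 2) * wallis (S (S n)) - (INR n + 1) * wallis n)).
  { apply (is_RInt_minus (V := R_NormedModule)
      (fun t => (INR n + 2) * sin t ^ (S (S n))) (fun t => (INR n + 1) * sin t ^ n));
      apply (is_RInt_scal (V := R_NormedModule)); apply (RInt_correct (fun t => sin t ^ _));
      apply ex_RInt_sin_pow. }
  pose proof (is_RInt_unique _ _ _ _ H); pose proof (is_RInt_unique _ _ _ _ H2); lra.
Qed.

Lemma wallis_2 : wallis 2 = PI / 4.
Proof.
  pose proof (wallis_SS 0) as H; simpl INR in H.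
  assert (H0 : wallis 0 = PI / 2).
  { unfold wallis; rewrite (RInt_ext _ (fun _ => 1)) by reflexivity.
    rewrite RInt_const; unfold scal; simpl; unfold mult; simpl; ring. }
  lra.
Qed.

(* The recurrence makes [u (2k) / u 0 = v (2k) / v 0] and [u (2k+1) / u 1 = v (2k+1) / v 1],
   while monotonicity forces consecutive terms of each sequence to be asymptotically equal. *)
Lemma wallis_recurrence_le (u v : nat -> R) :
  (forall n, 0 < u n) -> (forall n, 0 < v n) ->
  (forall n, u (S n) <= u n) -> (forall n, v (S n) <= v n) ->
  (forall n, (INR n + 3) * u (S (S n)) = (INR n + 2) * u n) ->
  (forall n, (INR n + 3) * v (S (S n)) = (INR n + 2) * v n) ->
  u 0%nat * v 1%nat <= v 0%nat * u 1%nat.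
Proof.
  intros Pu Pv Du Dv Ru Rv.
  assert (E0 : forall k, u (2 * k)%nat * v 0%nat = v (2 * k)%nat * u 0%nat).
  { induction k as [|k IH]; [simpl; ring|].
    replace (2 * S k)%nat with (S (S (2 * k))) by lia.
    pose proof (pos_INR (2 * k)).
    apply Rmult_eq_reg_l with (INR (2 * k) + 3); [|lra].
    rewrite <- !Rmult_assoc, Ru, Rv, !Rmult_assoc, IH; ring. }
  assert (E1 : forall k, u (S (2 * k))%nat * v 1%nat = v (S (2 * k))%nat * u 1%nat).
  { induction k as [|k IH]; [simpl; ring|].
    replace (2 * S k)%nat with (S (S (2 * k))) by lia.
    pose proof (pos_INR (S (2 * k))).
    apply Rmult_eq_reg_l with (INR (S (2 * k)) + 3); [|lra].
    rewrite <- !Rmult_assoc, Ru, Rv, !Rmult_assoc, IH; ring. }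
  (* The inequality sought, up to a factor [(2k + 3) / (2k + 2)] that tends to 1:
     [u (m+2) <= u (m+1)] bounds [u m / u (m+1)] by [(m+3) / (m+2)], while [v (m+1) <= v m]. *)
  assert (HK : forall k, (INR (2 * k) + 2) * (u 0%nat * v 1%nat)
                         <= (INR (2 * k) + 3) * (v 0%nat * u 1%nat)).
  { intros k; set (m := (2 * k)%nat).
    assert (H1 : (INR m + 2) * u m <= (INR m + 3) * u (S m)).
    { rewrite <- Ru; apply Rmult_le_compat_l; [pose proof (pos_INR m); lra | apply Du]. }
    assert (H2 : (INR m + 2) * u m * v (S m) <= (INR m + 3) * u (S m) * v m).
    { apply Rmult_le_compat; auto; [|now apply Rlt_le].
      apply Rmult_le_pos; [pose proof (pos_INR m); lra | now apply Rlt_le]. }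
    assert (Hp : 0 < u 0%nat * v 1%nat) by now apply Rmult_lt_0_compat.
    apply Rmult_le_reg_r with (v m * v (S m)); [now apply Rmult_lt_0_compat|].
    replace ((INR m + 2) * (u 0%nat * v 1%nat) * (v m * v (S m))) with
      ((INR m + 2) * (v m * u 0%nat) * v (S m) * v 1%nat) by ring.
    unfold m at 2; rewrite <- E0; fold m.
    replace ((INR m + 3) * (v 0%nat * u 1%nat) * (v m * v (S m))) with
      ((INR m + 3) * v 0%nat * (v (S m) * u 1%nat) * v m) by ring.
    unfold m at 5; rewrite <- E1; fold m.
    replace ((INR m + 2) * (u m * v 0%nat) * v (S m) * v 1%nat) with
      ((INR m + 2) * u m * v (S m) * (v 0%nat * v 1%nat)) by ring.
    replace ((INR m + 3) * v 0%nat * (u (S m) * v 1%nat) * v m) with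
      ((INR m + 3) * u (S m) * v m * (v 0%nat * v 1%nat)) by ring.
    apply Rmult_le_compat_r; [|exact H2].
    apply Rlt_le; now apply Rmult_lt_0_compat. }
  set (p := u 0%nat * v 1%nat) in *; set (q := v 0%nat * u 1%nat) in *.
  assert (Hq : 0 < q) by now apply Rmult_lt_0_compat.
  apply Rnot_lt_le; intros Hlt.
  (* If [p > q], then [HK] says [(2k + 2) (p - q) <= q] for all [k], which fails once
     [k + 1 > q / (p - q)]. *)
  destruct (nfloor_ex (q / (p - q))) as [k [_ Hk]].
  { apply Rdiv_le_0_compat; lra. }
  specialize (HK k); rewrite mult_INR in HK; simpl (INR 2) in HK.
  apply Rmult_lt_compat_r with (r := p - q) in Hk; [|lra].
  replace (q / (p - q) * (p - q)) with q in Hk by (field; lra); nra.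
Qed.

(** Ratios of consecutive [Gamma_half] values and the Wallis integrals are decreasing and obey the
    same recurrence. Comparing them in both directions gives [PI / (4 g) = g] for
    [g = Gamma_half 1]. *)
Lemma Gamma_half_1 : Gamma_half 1 = sqrt PI / 2.
Proof.
  set (u := fun n => Gamma_half n / Gamma_half (S n)).
  set (v := fun n => wallis (S n)).
  assert (Pu : forall n, 0 < u n) by (intros; apply Rdiv_lt_0_compat; apply Gamma_half_pos).
  assert (Pv : forall n, 0 < v n) by (intros; apply wallis_pos).
  (* Cross-multiplied, this is the square of [Gamma_half_S_le]. *)
  assert (Du : forall n, u (S n) <= u n).
  { intros n; unfold u.
    pose proof (Gamma_half_pos n); pose proof (Gamma_half_pos (S n)).
    pose proof (Gamma_half_S_le n) as Hle; pose proof (pos_INR n).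
    rewrite Gamma_half_SS.
    pose proof (sqrt_sqrt ((INR n + 2) / 2) ltac:(lra)) as Hs.
    pose proof (sqrt_lt_R0 ((INR n + 2) / 2) ltac:(lra)).
    apply Rmult_le_reg_r with ((INR n + 2) / 2 * Gamma_half n * Gamma_half (S n)).
    { apply Rmult_lt_0_compat; [apply Rmult_lt_0_compat|]; lra. }
    replace (Gamma_half (S n) / _ * _) with (Gamma_half (S n) * Gamma_half (S n)) by (field; lra).
    replace (Gamma_half n / _ * _) with
      (((INR n + 2) / 2) * Gamma_half n * Gamma_half n) by (field; lra).
    rewrite <- Hs.
    replace (sqrt ((INR n + 2) / 2) * sqrt ((INR n + 2) / 2) * Gamma_half n * Gamma_half n) with
      ((sqrt ((INR n + 2) / 2) * Gamma_half n) * (sqrt ((INR n + 2) / 2) * Gamma_half n)) by ring.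
    apply Rmult_le_compat; lra. }
  assert (Dv : forall n, v (S n) <= v n) by (intros; apply wallis_decr).
  assert (Ru : forall n, (INR n + 3) * u (S (S n)) = (INR n + 2) * u n).
  { intros n; unfold u; rewrite (Gamma_half_SS (S n)), (Gamma_half_SS n), S_INR.
    pose proof (Gamma_half_pos n); pose proof (Gamma_half_pos (S n)); pose proof (pos_INR n).
    field; lra. }
  assert (Rv : forall n, (INR n + 3) * v (S (S n)) = (INR n + 2) * v n).
  { intros n; unfold v; pose proof (wallis_SS (S n)) as H; rewrite S_INR in H.
    replace (INR n + 3) with (INR n + 1 + 2) by ring.
    replace (INR n + 2) with (INR n + 1 + 1) by ring; exact H. }
  pose proof (wallis_recurrence_le u v Pu Pv Du Dv Ru Rv) as H1.
  pose proof (wallis_recurrence_le v u Pv Pu Dv Du Rv Ru) as H2.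
  unfold u, v in H1, H2; rewrite Gamma_half_SS, Gamma_half_0, wallis_1, wallis_2 in *.
  pose proof (Gamma_half_pos 1) as HG; set (g := Gamma_half 1) in *.
  simpl INR in *.
  replace (g / ((0 + 2) / 2 * 1)) with g in * by field.
  assert (E : 1 / g * (PI / 4) = 1 * g) by lra.
  assert (E2 : PI = (2 * g) * (2 * g)).
  { replace PI with (4 * g * (1 / g * (PI / 4))) by (field; lra); rewrite E; ring. }
  rewrite E2, sqrt_square by lra; field.
Qed.

(** Legendre's duplication formula at [z = n/2 + 1]. At integers and half-integers induction
    suffices: both sides gain the factor [n + 2], and [Gamma_half_1] starts it. *)
Lemma Gamma_half_duplication (n : nat) :
  Gamma_half n * Gamma_half (S n) * 2 ^ S n = sqrt PI * Gamma_half (2 * n + 2).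
Proof.
  induction n as [|n IH].
  - change (2 * 0 + 2)%nat with 2%nat; rewrite Gamma_half_SS, Gamma_half_0, Gamma_half_1; simpl; field.
  - replace (2 * S n + 2)%nat with (S (S (2 * n + 2))) by lia.
    rewrite Gamma_half_SS, Gamma_half_SS.
    replace (INR (2 * n + 2)) with (2 * INR n + 2) by (rewrite plus_INR, mult_INR; simpl; ring).
    replace (sqrt PI * ((2 * INR n + 2 + 2) / 2 * Gamma_half (2 * n + 2))) with
      ((INR n + 2) * (sqrt PI * Gamma_half (2 * n + 2))) by field.
    rewrite <- IH; simpl pow; field.
Qed.

(** * Stirling's series *)

(** The sequences [u - c] and [u + c] are adjacent: one increases, the other decreases, and they
    enclose [u] and its limit. *)
Lemma telescoping_limit (u c : nat -> R) :
  (forall k, Rabs (u (S k) - u k) <= c k - c (S k)) -> is_lim_seq c 0 ->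
  exists l : R, is_lim_seq u l /\ forall k, Rabs (u k - l) <= c k.
Proof.
  intros Hu Hc.
  assert (Hi : forall k, u k - c k <= u (S k) - c (S k)).
  { intros k; pose proof (Rle_abs (- (u (S k) - u k))); rewrite Rabs_Ropp in *.
    specialize (Hu k); lra. }
  assert (Hd : forall k, u (S k) + c (S k) <= u k + c k).
  { intros k; pose proof (Rle_abs (u (S k) - u k)); specialize (Hu k); lra. }
  destruct (ex_lim_seq_adj (fun k => u k - c k) (fun k => u k + c k) Hi Hd) as [[l Hl] _].
  { apply is_lim_seq_ext with (fun k => 2 * c k); [intros; ring|].
    replace (Finite 0) with (Rbar_mult 2 0) by (simpl; f_equal; ring).
    now apply is_lim_seq_scal_l. }
  assert (Hlu : is_lim_seq u l).
  { apply is_lim_seq_ext with (fun k => (u k - c k) + c k); [intros; ring|].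
    replace (Finite l) with (Finite (l + 0)) by (f_equal; ring).
    now apply is_lim_seq_plus'. }
  exists l; split; [exact Hlu|]; intros k.
  pose proof (is_lim_seq_incr_compare _ _ Hl Hi k) as H1; simpl in H1.
  assert (Hl' : is_lim_seq (fun k => u k + c k) l).
  { replace (Finite l) with (Finite (l + 0)) by (f_equal; ring).
    now apply is_lim_seq_plus'. }
  pose proof (is_lim_seq_decr_compare _ _ Hl' Hd k) as H2; simpl in H2.
  apply Rabs_le; lra.
Qed.

(** Telescoping majorant for the step errors. Replacing [y^p] by the larger [(y + 1)^p] reduces it
    to [1 / y - 1 / (y + 1) = 1 / (y (y + 1))]. *)
Lemma inv_pow_diff (y : R) (p : nat) : 0 < y ->
  / (y + 1) ^ S (S p) <= / y ^ S p - / (y + 1) ^ S p.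
Proof.
  intros Hy; simpl pow.
  assert (Ha : 0 < y ^ p) by now apply pow_lt.
  assert (Hab : y ^ p <= (y + 1) ^ p) by (apply pow_incr; lra).
  set (a := y ^ p) in *; set (b := (y + 1) ^ p) in *.
  apply Rle_trans with (/ (y * b) - / ((y + 1) * b)).
  - replace (/ (y * b) - / ((y + 1) * b)) with (/ (y * ((y + 1) * b))) by (field; lra).
    apply Rinv_le_contravar; repeat apply Rmult_lt_0_compat; try lra.
    apply Rmult_le_compat_r; [apply Rmult_le_pos|]; lra.
  - apply Rplus_le_compat_r, Rinv_le_contravar; [apply Rmult_lt_0_compat; lra|].
    apply Rmult_le_compat_l; lra.
Qed.

Lemma is_lim_seq_inv_pow (u : nat -> R) (p : nat) :
  is_lim_seq u p_infty -> is_lim_seq (fun n => / u n ^ S p) 0.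
Proof.
  intros Hu.
  assert (Hi : is_lim_seq (fun n => / u n) 0) by (apply (is_lim_seq_inv u p_infty Hu); discriminate).
  apply is_lim_seq_ext with (fun n => (/ u n) ^ S p); [intros; apply pow_inv|].
  induction p as [|p IH].
  - apply is_lim_seq_ext with (fun n => / u n); [intros; simpl; ring | exact Hi].
  - replace (Finite 0) with (Finite (0 * 0)) by (f_equal; ring).
    apply (is_lim_seq_mult' (fun n => / u n) (fun n => (/ u n) ^ S p)); assumption.
Qed.

Lemma is_lim_seq_half_INR : is_lim_seq (fun n => INR n / 2) p_infty.
Proof.
  apply (is_lim_seq_mult INR (fun _ => / 2) p_infty (/ 2));
    [apply is_lim_seq_INR | apply is_lim_seq_const|].
  apply is_Rbar_mult_p_infty_pos; simpl; lra.
Qed.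

Definition stirling_error (N n : nat) : R := ln (Gamma_half n) - stirling_sum N (INR n / 2).

Lemma stirling_error_step (N n : nat) : (0 < n)%nat ->
  Rabs (stirling_error (S N) (S (S n)) - stirling_error (S N) n)
  <= INR (S (S N)) * INR (fact N) / (INR n / 2) ^ S N.
Proof.
  intros Hn; unfold stirling_error.
  assert (Hx : 0 < INR n) by now apply lt_0_INR.
  replace (INR (S (S n)) / 2) with (INR n / 2 + 1) by (rewrite !S_INR; field).
  rewrite Gamma_half_SS, ln_mult; [| lra | apply Gamma_half_pos].
  replace ((INR n + 2) / 2) with (INR n / 2 + 1) by field.
  rewrite <- Rabs_Ropp.
  replace (- _) with (stirling_sum (S N) (INR n / 2 + 1) - stirling_sum (S N) (INR n / 2)
                      - ln (INR n / 2 + 1)) by ring.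
  apply stirling_sum_step; lra.
Qed.

Lemma stirling_error_parity_limit (p n : nat) : (3 <= n)%nat ->
  exists l : R, is_lim_seq (fun k => stirling_error (S (S p)) (n + 2 * k)) l /\
    Rabs (stirling_error (S (S p)) n - l)
    <= INR (S (S (S p))) * INR (fact (S p)) / (INR n / 2 - 1) ^ S p.
Proof.
  intros Hn.
  assert (Hx : 3 <= INR n) by (replace 3 with (INR 3) by (simpl; ring); now apply le_INR).
  set (K := INR (S (S (S p))) * INR (fact (S p))).
  assert (HK : 0 <= K) by (apply Rmult_le_pos; apply pos_INR).
  destruct (telescoping_limit (fun k => stirling_error (S (S p)) (n + 2 * k))
    (* The shift by 1 makes [y + 1] in [inv_pow_diff] equal to the argument [n/2 + k] of the step;
       [n >= 3] keeps [y] positive. *)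
    (fun k => K * / (INR n / 2 - 1 + INR k) ^ S p)) as [l [Hl Hb]].
  - intros k.
    replace (n + 2 * S k)%nat with (S (S (n + 2 * k))) by lia.
    eapply Rle_trans; [apply stirling_error_step; lia|]; fold K.
    rewrite <- Rmult_minus_distr_l; apply Rmult_le_compat_l; [exact HK|].
    rewrite plus_INR, mult_INR, (S_INR k); simpl (INR 2).
    replace ((INR n + (1 + 1) * INR k) / 2) with (INR n / 2 - 1 + INR k + 1) by field.
    replace (INR n / 2 - 1 + (INR k + 1)) with (INR n / 2 - 1 + INR k + 1) by ring.
    apply inv_pow_diff; pose proof (pos_INR k); lra.
  - replace (Finite 0) with (Rbar_mult K 0) by (simpl; f_equal; ring).
    apply is_lim_seq_scal_l, is_lim_seq_inv_pow.
    apply (is_lim_seq_plus (fun _ => INR n / 2 - 1) INR (INR n / 2 - 1) p_infty);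
      [apply is_lim_seq_const | apply is_lim_seq_INR | reflexivity].
  - exists l; split; [exact Hl|].
    specialize (Hb 0%nat); cbv beta in Hb.
    replace (n + 2 * 0)%nat with n in Hb by lia.
    simpl (INR 0) in Hb; rewrite Rplus_0_r in Hb; exact Hb.
Qed.

(** * Identification of the limit as [ln (2 PI) / 2] *)

Lemma beta_1 : beta 1 = - / 2.
Proof. rewrite beta_S; simpl; rewrite beta_0; unfold inv_fact_S; simpl; field. Qed.

Lemma stirling_sum_1 (x : R) : stirling_sum 1 x = x * ln x - x + / 2 * ln x.
Proof. unfold stirling_sum; simpl; rewrite beta_0, beta_1; ring. Qed.

Lemma stirling_sum_tail_lim (N : nat) :
  is_lim_seq (fun n => stirling_sum (S N) (INR n / 2) - stirling_sum 1 (INR n / 2)) 0.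
Proof.
  induction N as [|N IH].
  - apply is_lim_seq_ext with (fun _ => 0); [intros; ring | apply is_lim_seq_const].
  - apply is_lim_seq_ext with (fun n => (stirling_sum (S N) (INR n / 2) - stirling_sum 1 (INR n / 2))
      + beta (S (S N)) * INR (fact N) * / (INR n / 2) ^ S N).
    { intros n; unfold stirling_sum; rewrite (tech5 _ (S N)); unfold em_fun, Rdiv; ring. }
    replace (Finite 0) with (Finite (0 + beta (S (S N)) * INR (fact N) * 0)) by (f_equal; ring).
    apply is_lim_seq_plus'; [exact IH|].
    apply (is_lim_seq_scal_l _ (beta (S (S N)) * INR (fact N)) 0).
    apply is_lim_seq_inv_pow, is_lim_seq_half_INR.
Qed.

(** The terms with [k >= 2] vanish at infinity, so the constant can be computed at order 1, where
    the sum is [x ln x - x + ln x / 2]. *)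
Lemma stirling_error_lim_change (N : nat) (phi : nat -> nat) (l : R) :
  filterlim phi eventually eventually ->
  is_lim_seq (fun k => stirling_error (S N) (phi k)) l <->
  is_lim_seq (fun k => stirling_error 1 (phi k)) l.
Proof.
  intros Hphi.
  pose proof (is_lim_seq_subseq _ _ phi Hphi (stirling_sum_tail_lim N)) as Ht.
  cbv beta in Ht; split; intros Hl.
  - apply is_lim_seq_ext with (fun k => stirling_error (S N) (phi k) +
      (stirling_sum (S N) (INR (phi k) / 2) - stirling_sum 1 (INR (phi k) / 2)));
      [intros; unfold stirling_error; ring|].
    replace l with (l + 0) by ring; now apply is_lim_seq_plus'.
  - apply is_lim_seq_ext with (fun k => stirling_error 1 (phi k) -
      (stirling_sum (S N) (INR (phi k) / 2) - stirling_sum 1 (INR (phi k) / 2)));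
      [intros; unfold stirling_error; ring|].
    replace l with (l - 0) by ring; now apply is_lim_seq_minus'.
Qed.

Lemma eventually_arith (a b : nat) : filterlim (fun k => (a + S b * k)%nat) eventually eventually.
Proof. apply eventually_subseq; intros n; lia. Qed.

Lemma ln_succ_bounds (x : R) : 0 < x -> / (x + 1) <= ln (x + 1) - ln x <= / x.
Proof.
  intros Hx.
  assert (Hln : forall z, 0 < z -> ln z <= z - 1).
  { intros z Hz; pose proof (exp_ineq1_le (ln z)); rewrite exp_ln in *; lra. }
  rewrite <- ln_div by lra; split.
  - pose proof (Hln (x / (x + 1)) ltac:(apply Rdiv_lt_0_compat; lra)) as H.
    rewrite ln_div in H |- * by lra.
    replace (x / (x + 1) - 1) with (- / (x + 1)) in H by (field; lra); lra.
  - pose proof (Hln ((x + 1) / x) ltac:(apply Rdiv_lt_0_compat; lra)) as H.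
    replace ((x + 1) / x - 1) with (/ x) in H by (field; lra); exact H.
Qed.

Lemma mul_ln_succ_bounds (x : R) : 0 < x -> 1 - / x <= x * (ln (x + 1) - ln x) <= 1.
Proof.
  intros Hx; destruct (ln_succ_bounds x Hx) as [H1 H2]; split.
  - apply Rle_trans with (x * / (x + 1)); [|apply Rmult_le_compat_l; lra].
    apply Rminus_le_0.
    replace (x * / (x + 1) - (1 - / x)) with (/ (x * (x + 1))) by (field; lra).
    apply Rlt_le, Rinv_0_lt_compat, Rmult_lt_0_compat; lra.
  - apply Rle_trans with (x * / x); [apply Rmult_le_compat_l; lra | right; field; lra].
Qed.

Lemma ln_half (x : R) : 0 < x -> ln (x / 2) = ln x - ln 2.
Proof. intros; apply ln_div; lra. Qed.

(** The logarithm of [Gamma_half_S_le]. It compares the limits along the two parities. *)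
Lemma stirling_error_1_S_le (n : nat) : (0 < n)%nat ->
  stirling_error 1 (S n) <= stirling_error 1 n + / INR n.
Proof.
  intros Hn; unfold stirling_error; rewrite !stirling_sum_1.
  assert (Hx : 0 < INR n) by now apply lt_0_INR.
  assert (HG : ln (Gamma_half (S n)) <= / 2 * ln ((INR n + 2) / 2) + ln (Gamma_half n)).
  { assert (Hq : 0 < sqrt ((INR n + 2) / 2)) by (apply sqrt_lt_R0; lra).
    replace (/ 2 * ln ((INR n + 2) / 2)) with (ln (sqrt ((INR n + 2) / 2))).
    - rewrite <- ln_mult; [| exact Hq | apply Gamma_half_pos].
      apply ln_le; [apply Gamma_half_pos | apply Gamma_half_S_le].
    - rewrite <- Rpower_sqrt by lra; unfold Rpower; apply ln_exp. }
  rewrite S_INR; rewrite !ln_half in * by lra.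
  pose proof (ln_succ_bounds (INR n) Hx) as [H1 H2].
  pose proof (ln_succ_bounds (INR n + 1) ltac:(lra)) as [_ H3].
  replace (INR n + 1 + 1) with (INR n + 2) in H3 by ring.
  pose proof (mul_ln_succ_bounds (INR n) Hx) as H4.
  assert (H5 : / (INR n + 1) <= / INR n) by (apply Rinv_le_contravar; lra).
  assert (0 < / (INR n + 1)) by (apply Rinv_0_lt_compat; lra).
  lra.
Qed.

(** After taking logarithms in the duplication formula, what remains besides the constant is
    [((n + 1) (ln (n + 1) - ln n) - 1) / 2], which is [O(1/n)]. *)
Lemma stirling_error_duplication (n : nat) : (0 < n)%nat ->
  Rabs (stirling_error 1 n + stirling_error 1 (S n) - stirling_error 1 (2 * n + 2)
        - / 2 * ln (2 * PI)) <= / INR n.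
Proof.
  intros Hn; unfold stirling_error; rewrite !stirling_sum_1.
  assert (Hx : 0 < INR n) by now apply lt_0_INR.
  pose proof PI_RGT_0 as HPI.
  assert (HG : ln (Gamma_half n) + ln (Gamma_half (S n)) + (INR n + 1) * ln 2
               = / 2 * ln PI + ln (Gamma_half (2 * n + 2))).
  { pose proof (f_equal ln (Gamma_half_duplication n)) as H.
    assert (H2 : 0 < 2 ^ S n) by (apply pow_lt; lra).
    pose proof (Gamma_half_pos n); pose proof (Gamma_half_pos (S n)).
    rewrite !ln_mult, ln_pow, S_INR in H
      by (repeat first [assumption | apply Gamma_half_pos | now apply sqrt_lt_R0 | lra
                       | apply Rmult_lt_0_compat]).
    rewrite H; f_equal.
    rewrite <- Rpower_sqrt by lra; unfold Rpower; apply ln_exp. }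
  replace (INR (2 * n + 2) / 2) with (INR n + 1)
    by (rewrite plus_INR, mult_INR; simpl; field).
  rewrite S_INR, ln_mult, !ln_half by lra.
  pose proof (ln_succ_bounds (INR n) Hx) as [H1 H2].
  pose proof (mul_ln_succ_bounds (INR n) Hx) as H4.
  assert (0 < / (INR n + 1)) by (apply Rinv_0_lt_compat; lra).
  apply Rabs_le; split; lra.
Qed.

Lemma is_lim_seq_inv_arith (a b : nat) : is_lim_seq (fun k => / INR (a + S b * k)) 0.
Proof.
  apply (is_lim_seq_subseq (fun n => / INR n) 0 _ (eventually_arith a b)).
  apply (is_lim_seq_inv INR p_infty is_lim_seq_INR); discriminate.
Qed.

Lemma stirling_error_lim (N n : nat) :
  (3 <= n)%nat -> is_lim_seq (fun k => stirling_error (S N) (n + 2 * k)) (/ 2 * ln (2 * PI)).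
Proof.
  intros Hn.
  apply (proj2 (stirling_error_lim_change N _ (/ 2 * ln (2 * PI)) (eventually_arith n 1))).
  assert (Hlim : forall m, (3 <= m)%nat ->
    exists l : R, is_lim_seq (fun k => stirling_error 1 (m + 2 * k)) l).
  { intros m Hm; destruct (stirling_error_parity_limit 0 m Hm) as [l [Hl _]].
    exists l; exact (proj1 (stirling_error_lim_change 1 _ l (eventually_arith m 1)) Hl). }
  assert (Hle : forall m (l l' : R), (3 <= m)%nat ->
    is_lim_seq (fun k => stirling_error 1 (m + 2 * k)) l ->
    is_lim_seq (fun k => stirling_error 1 (S m + 2 * k)) l' -> l' <= l).
  { intros m l l' Hm Hl Hl'.
    replace l with (l + 0) by ring.
    apply (is_lim_seq_le _ (fun k => stirling_error 1 (m + 2 * k) + / INR (m + 2 * k)) l' (l + 0)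
      (fun k => stirling_error_1_S_le (m + 2 * k) ltac:(lia)) Hl').
    apply is_lim_seq_plus'; [exact Hl | apply (is_lim_seq_inv_arith m 1)]. }
  destruct (Hlim n Hn) as [l Hl]; destruct (Hlim (S n) ltac:(lia)) as [l' Hl'].
  assert (Hl2 : is_lim_seq (fun k => stirling_error 1 (S (S n) + 2 * k)) l).
  { apply is_lim_seq_ext with (fun k => stirling_error 1 (n + 2 * S k)).
    - intros k; f_equal; lia.
    - apply (is_lim_seq_incr_1 (fun k => stirling_error 1 (n + 2 * k))), Hl. }
  (* Going from [n] to [n + 1] and on to [n + 2], which lies on the progression of [n] again, gives
     [l' <= l <= l']. *)
  pose proof (Hle n l l' Hn Hl Hl').
  pose proof (Hle (S n) l' l ltac:(lia) Hl' Hl2).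
  assert (l' = l) by lra; subst l'; clear Hl2.
  (* The doubled index [2 * (n + 2 * k) + 2] is even, so it runs along the progression of whichever
     of [n], [n + 1] is even. *)
  assert (He : exists m : nat, ((m = n \/ m = S n) /\ exists j, m = 2 * j)%nat).
  { destruct (Nat.Even_or_Odd n) as [[j Hj]|[j Hj]].
    - exists n; split; [now left | now exists j].
    - exists (S n); split; [now right | exists (S j); lia]. }
  destruct He as [m [Hm [j Hj]]].
  assert (Hlm : is_lim_seq (fun k => stirling_error 1 (m + 2 * k)) l)
    by (destruct Hm as [-> | ->]; assumption).
  assert (Hld : is_lim_seq (fun k => stirling_error 1 (2 * (n + 2 * k) + 2)) l).
  { apply is_lim_seq_ext with (fun k => stirling_error 1 (m + 2 * (n + 1 - j + 2 * k))).
    - intros k; f_equal; lia.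
    - apply (is_lim_seq_subseq (fun k => stirling_error 1 (m + 2 * k)) l _
        (eventually_arith (n + 1 - j) 1) Hlm). }
  replace (/ 2 * ln (2 * PI)) with l; [exact Hl|].
  assert (Hz : is_lim_seq (fun k => stirling_error 1 (n + 2 * k) + stirling_error 1 (S (n + 2 * k))
     - stirling_error 1 (2 * (n + 2 * k) + 2) - / 2 * ln (2 * PI)) 0).
  { apply is_lim_seq_abs_0.
    apply is_lim_seq_le_le with (fun _ => 0) (fun k => / INR (n + 2 * k)).
    - intros k; split; [apply Rabs_pos | apply stirling_error_duplication; lia].
    - apply is_lim_seq_const.
    - apply (is_lim_seq_inv_arith n 1). }
  (* All three errors tend to [l], so [l + l - l] must equal the duplication constant. *)
  assert (Hw : is_lim_seq (fun k => stirling_error 1 (n + 2 * k) + stirling_error 1 (S (n + 2 * k))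
     - stirling_error 1 (2 * (n + 2 * k) + 2) - / 2 * ln (2 * PI)) (l + l - l - / 2 * ln (2 * PI))).
  { apply is_lim_seq_minus'; [|apply is_lim_seq_const].
    apply is_lim_seq_minus'; [|exact Hld].
    apply is_lim_seq_plus'; [exact Hl | exact Hl']. }
  pose proof (is_lim_seq_unique _ _ Hz) as E0; rewrite (is_lim_seq_unique _ _ Hw) in E0.
  injection E0; lra.
Qed.

Lemma stirling_error_bound (p n : nat) : (4 <= n)%nat ->
  Rabs (stirling_error (S (S p)) n - / 2 * ln (2 * PI))
  <= INR (S (S (S p))) * INR (fact (S p)) * 4 ^ S p / INR n ^ S p.
Proof.
  intros Hn.
  assert (Hx : 4 <= INR n) by (replace 4 with (INR 4) by (simpl; ring); now apply le_INR).
  destruct (stirling_error_parity_limit p n ltac:(lia)) as [l [Hl Hb]].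
  pose proof (stirling_error_lim (S p) n ltac:(lia)) as Hl2.
  assert (E : Finite l = Finite (/ 2 * ln (2 * PI)))
    by (rewrite <- (is_lim_seq_unique _ _ Hl); exact (is_lim_seq_unique _ _ Hl2)).
  injection E as <-.
  eapply Rle_trans; [exact Hb|]; unfold Rdiv; rewrite Rmult_assoc.
  rewrite Rmult_assoc, <- Rmult_assoc.
  apply Rmult_le_compat_l; [apply Rmult_le_pos; apply pos_INR|].
  (* For [n >= 4] one has [n/2 - 1 >= n/4], whence the factor [4^(p+1)]. *)
  replace (4 ^ S p * / INR n ^ S p) with (/ (INR n / 4) ^ S p).
  - apply Rinv_le_contravar; [apply pow_lt; lra | apply pow_incr; lra].
  - unfold Rdiv; rewrite Rpow_mult_distr, pow_inv, Rinv_mult, Rinv_inv; ring.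
Qed.

(** * Coefficients of the series and the final remainder *)

Lemma coeff_SS (j : nat) :
  coeff (S (S j)) = - (beta (S (S j)) * INR (fact j) * 2 ^ S j).
Proof.
  unfold coeff; destruct (Nat.odd (S (S j))) eqn:Ho.
  (* For odd index the left side is 0 by definition and the right side because [beta] vanishes
     there. *)
  - apply Nat.odd_spec in Ho; destruct Ho as [i Hi].
    pose proof (Bernoulli_odd (i - 1)) as HB; rewrite Bernoulli_beta in HB.
    replace (2 * (i - 1) + 3)%nat with (S (S j)) in HB by lia.
    pose proof (INR_fact_neq_0 (S (S j))).
    destruct (Rmult_integral _ _ HB) as [-> | HF]; [ring | contradiction].
  - assert (He : Nat.Even (S (S j))).
    { apply Nat.even_spec; rewrite <- Nat.negb_odd, Ho; reflexivity. }
    destruct He as [i Hi]; rewrite Hi, Nat.div2_double.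
    replace (2 * i - 2)%nat with j by lia.
    rewrite <- Hi, Bernoulli_beta.
    (* With [j + 2 = 2 i], [(2i)! = 2i (2i - 1) j!] cancels the denominator [i (2i - 1)] and turns
       [2^j] into [2^(j+1)]. *)
    change (fact (S (S j))) with (S (S j) * (S j * fact j))%nat.
    rewrite !mult_INR.
    assert (H1 : INR (S (S j)) = 2 * INR i) by (rewrite Hi, mult_INR; simpl; ring).
    assert (H2 : INR (S j) = 2 * INR i - 1) by (rewrite <- H1, (S_INR (S j)); ring).
    assert (0 < INR (S j)) by (apply lt_0_INR; lia).
    rewrite H1, H2; simpl pow; field; lra.
Qed.

Lemma sum_1_S (a : nat -> R) (n : nat) : sum_n_m a 1 (S n) = sum_n_m a 1 n + a (S n).
Proof. apply (sum_n_Sm a 1 n); lia. Qed.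

(** For [k >= 2], [em_fun k (n/2) = (k - 2)! (2/n)^(k-1)], so [coeff_SS] matches the sums term by
    term. At [N = 0] both sides vanish since [coeff 1 = 0]. *)
Lemma sum_coeff_stirling (N n : nat) : (0 < n)%nat ->
  INR n * sum_n_m (fun k => coeff k / INR n ^ k) 1 (S N)
  = stirling_sum 1 (INR n / 2) - stirling_sum (S N) (INR n / 2).
Proof.
  intros Hn; assert (Hx : 0 < INR n) by now apply lt_0_INR.
  induction N as [|N IH].
  - rewrite sum_n_n; change (coeff 1) with 0; unfold Rdiv; ring.
  - rewrite sum_1_S.
    rewrite Rmult_plus_distr_l, IH, coeff_SS.
    unfold stirling_sum; rewrite (tech5 _ (S N)); unfold em_fun.
    replace ((INR n / 2) ^ S N) with (INR n ^ S N / 2 ^ S N)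
      by (unfold Rdiv; rewrite Rpow_mult_distr, pow_inv; ring).
    pose proof (pow_lt (INR n) (S N) Hx); pose proof (pow_lt 2 (S N) ltac:(lra)).
    change (INR n ^ S (S N)) with (INR n * INR n ^ S N); field; lra.
Qed.

Lemma ln_Omega_remainder (N n : nat) : (0 < n)%nat ->
  ln (Omega n) / INR n - main_part n - sum_n_m (fun k => coeff k / INR n ^ k) 1 (S N)
  = - (stirling_error (S N) n - / 2 * ln (2 * PI)) / INR n.
Proof.
  intros Hn; assert (Hx : 0 < INR n) by now apply lt_0_INR.
  pose proof PI_RGT_0; pose proof (exp_pos 1).
  assert (HO : ln (Omega n) = INR n / 2 * ln PI - ln (Gamma_half n)).
  { unfold Omega; rewrite ln_div; [| apply exp_pos | apply (Gamma_half_pos n)].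
    unfold Rpower; rewrite ln_exp; reflexivity. }
  rewrite HO; unfold main_part; rewrite (ln_mult PI), ln_exp by lra.
  apply Rmult_eq_reg_l with (INR n); [|lra].
  rewrite Rmult_minus_distr_l, sum_coeff_stirling by exact Hn.
  unfold stirling_error; rewrite stirling_sum_1; field; lra.
Qed.

(* (1/n) ln Omega_n ~ main_part n + sum_{k>=1} coeff k * n^{-k}:
   for every N, the remainder after the first N terms is O(n^{-N-1}) as n -> oo. *)
Theorem theorem1 :
  forall N : nat, exists (C : R) (M : nat), forall n : nat, (M <= n)%nat ->
    Rabs (ln (Omega n) / INR n - main_part n
          - sum_n_m (fun k => coeff k / INR n ^ k) 1 N)
    <= C / INR n ^ (N + 1).
Proof.
  intros N.
  set (K := INR (S (S (S N))) * INR (fact (S N)) * 4 ^ S N).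
  (* The estimate is taken at order [N + 2], where the error bound is [K / n^(N+1)]; the two extra
     terms of the series are absorbed into the constant. The threshold 4 is that of
     [stirling_error_bound]. *)
  exists (K + Rabs (coeff (S N)) + Rabs (coeff (S (S N)))), 4%nat; intros n Hn.
  assert (Hx : 4 <= INR n) by (replace 4 with (INR 4) by (simpl; ring); now apply le_INR).
  replace (N + 1)%nat with (S N) by lia.
  pose proof (pow_lt (INR n) (S N) ltac:(lra)) as Hp.
  pose proof (ln_Omega_remainder (S N) n ltac:(lia)) as HR.
  pose proof (stirling_error_bound N n Hn) as HB; fold K in HB.
  rewrite !sum_1_S in HR.
  set (r := ln (Omega n) / INR n - main_part n - sum_n_m (fun k => coeff k / INR n ^ k) 1 N).
  set (e := stirling_error (S (S N)) n - / 2 * ln (2 * PI)) in *.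
  replace r with (- e / INR n + (coeff (S N) / INR n ^ S N + coeff (S (S N)) / INR n ^ S (S N)))
    by (unfold r; rewrite <- HR; ring).
  assert (Hdiv : forall z, Rabs (z / INR n) <= Rabs z).
  { intros z; unfold Rdiv; rewrite Rabs_mult, Rabs_inv, (Rabs_pos_eq (INR n)) by lra.
    rewrite <- (Rmult_1_r (Rabs z)) at 2; apply Rmult_le_compat_l; [apply Rabs_pos|].
    rewrite <- Rinv_1; apply Rinv_le_contravar; lra. }
  replace (coeff (S (S N)) / INR n ^ S (S N)) with (coeff (S (S N)) / INR n ^ S N / INR n)
    by (change (INR n ^ S (S N)) with (INR n * INR n ^ S N); field; lra).
  apply Rle_trans with (K / INR n ^ S N +
    (Rabs (coeff (S N)) / INR n ^ S N + Rabs (coeff (S (S N))) / INR n ^ S N));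
    [|right; field; lra].
  assert (Hc : forall c, Rabs (c / INR n ^ S N) = Rabs c / INR n ^ S N)
    by (intros c; unfold Rdiv; rewrite Rabs_mult, Rabs_inv, (Rabs_pos_eq (INR n ^ S N)); lra).
  eapply Rle_trans; [apply Rabs_triang|].
  apply Rplus_le_compat.
  - eapply Rle_trans; [apply Hdiv|]; rewrite Rabs_Ropp; exact HB.
  - eapply Rle_trans; [apply Rabs_triang|]; apply Rplus_le_compat.
    + rewrite Hc; apply Rle_refl.
    + eapply Rle_trans; [apply Hdiv|]; rewrite Hc; apply Rle_refl.
Qed.
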